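(* Let $(X,\|\cdot\|)$ be a normed linear space, let $r\ge 0$ and $0<\alpha\le 1$, and let $x=\{x_n\}_{n\in\mathbb{N}}$ be a sequence in $X$. Then the rough statistical limit set of order $\alpha$, $st\text{-}LIM_x^{r^{\alpha}}$, is a closed subset of $X$.
   Context: Let $x=\{x_n\}_{n\in\mathbb{N}}$ be a sequence in a normed linear space $(X,\|\cdot\|)$, $0<\alpha\le 1$ and $r\ge 0$. The sequence $x$ is rough statistically convergent of order $\alpha$ to $\xi\in X$ (with roughness degree $r$) if for every $\varepsilon>0$, $\lim_{n\to\infty}\frac{1}{n^{\alpha}}|\{k\le n:\|x_k-\xi\|\ge r+\varepsilon\}|=0$. The set of all such $\xi\in X$ is denoted $st\text{-}LIM_x^{r^{\alpha}}$. Here $|A|$ is the number of elements of $A$, and $r^{\alpha}$ in the notation is only a label recording $r$ and $\alpha$, not a power. *)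

(* Defs.v *)
From HB Require Import structures.
From mathcomp Require Import all_boot all_order all_algebra.
From mathcomp Require Import all_classical all_reals all_analysis.
Import Order.TTheory GRing.Theory Num.Theory.
Import numFieldNormedType.Exports.

Set Implicit Arguments.
Unset Strict Implicit.
Unset Printing Implicit Defensive.

Local Open Scope classical_set_scope.
Local Open Scope ring_scope.

(* Sequences are indexed by the positive integers: a sequence is a function on *)
(* nat whose value at 0 is never used.                                         *)
Definition rough_count (R : realType) (X : normedModType R)
    (x : nat -> X) (xi : X) (c : R) (n : nat) : nat :=
  #|[set k : 'I_n.+1 | (1 <= k)%N && (c <= `|x k - xi|)]%SET|.

Definition rough_stat_cvg (R : realType) (X : normedModType R)
    (r alpha : R) (x : nat -> X) (xi : X) : Prop :=
  forall eps : R, 0 < eps ->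
    (1 / (n%:R `^ alpha) * (rough_count x xi (r + eps) n)%:R)
      @[n --> \oo] --> (0 : R).

Definition rough_stat_LIM (R : realType) (X : normedModType R)
    (r alpha : R) (x : nat -> X) : set X :=
  [set xi | rough_stat_cvg r alpha x xi].

(* Main.v *)
Require Import Defs.
From HB Require Import structures.
From mathcomp Require Import all_boot all_order all_algebra.
From mathcomp Require Import all_classical all_reals all_analysis.
From mathcomp Require Import lra.
Import Order.TTheory GRing.Theory Num.Theory.
Import numFieldNormedType.Exports.

Local Open Scope classical_set_scope.
Local Open Scope ring_scope.

(** A point [xi] of the closure has a rough limit [eta] within [eps / 2]. By the triangle
    inequality, each index [k] with [x k] at distance at least [r + eps] from [xi] has [x k] at
    distance at least [r + eps / 2] from [eta]. So the weighted count for [xi] lies between 0 and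
    the one for [eta], which tends to 0. *)

Lemma leq_rough_count (R : realType) (X : normedModType R) (x : nat -> X)
    (xi eta : X) (c d : R) (n : nat) :
  `|xi - eta| <= d - c ->
  (rough_count x xi d n <= rough_count x eta c n)%N.
Proof.
move=> xi_eta; apply/subset_leq_card/fintype.subsetP => k.
rewrite !inE => /andP[-> /= dk].
have := ler_distD eta (x k) xi; rewrite (distrC eta xi); lra.
Qed.

Theorem theorem3p3 (R : realType) (X : normedModType R) (r alpha : R)
    (hr : 0 <= r) (halpha0 : 0 < alpha) (halpha1 : alpha <= 1)
    (x : nat -> X) :
  closed (rough_stat_LIM r alpha x).
Proof.
move=> xi xi_cl eps eps0.
have eps20 : 0 < eps / 2 by rewrite divr_gt0.
have [eta [eta_lim]] := xi_cl _ (nbhsx_ballx xi _ eps20).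
rewrite -ball_normE /= => /ltW xi_eta.
apply: (squeeze_cvgr _ (cvg_cst 0) (eta_lim _ eps20)).
(* Both bounds hold for every [n]: the weight is nonnegative, so only the counts need comparing. *)
near=> n; rewrite mulr_ge0 ?divr_ge0 ?powR_ge0 //=.
(* The gap between the thresholds [r + eps] and [r + eps / 2] is exactly the radius of the ball
   containing [eta]. *)
rewrite ler_wpM2l ?divr_ge0 ?powR_ge0 // ler_nat leq_rough_count //; lra.
Unshelve. all: by end_near.
Qed.
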